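(* Let $R$ be the feasible set of either $(\mathrm{SDP_{GSRT\text{-}A}})$ or (when $c_i\in\mathrm{Range}(Q_i)$ for all $i\in\mathcal{N}$) $(\mathrm{SDP_{GSRT\text{-}B}})$, as defined in the context, let $(\mathrm{SDP}_R)$ be the problem of minimizing $Q_0\cdot X+c_0^Tx$ over $R$, and let $(\mathrm{SDP}_{R+\mathrm{SST}})$ be the problem of minimizing $Q_0\cdot X+c_0^Tx$ over the points of $R$ that also satisfy the SST constraints $$\left\|C^sX(C^t)^T+C^sx(\xi^t)^T+\xi^sx^T(C^t)^T+\xi^s(\xi^t)^T\right\|_F\le\beta_{s,t}\qquad\forall\,1\le s<t\le2l-k,$$ where $$\beta_{s,t}=(\zeta^s)^TX\zeta^t+(\zeta^s)^TS\eta^t+(\zeta^t)^TS\eta^s+(\eta^s)^TZ\eta^t+(\theta^s\zeta^t+\theta^t\zeta^s)^Tx+(\theta^s\eta^t+\theta^t\eta^s)^Tz+\theta^s\theta^t .$$ Then $$v(\mathrm{P})\ \ge\ v(\mathrm{SDP}_{R+\mathrm{SST}})\ \ge\ v(\mathrm{SDP}_R),$$ where $v(\cdot)$ denotes the optimal value (infimum, $+\infty$ if infeasible).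
   Context: Data: $Q_0,\dots,Q_l$ real symmetric $n\times n$ matrices ($Q_i\ne 0$ for $i\ge 1$), $c_0,\dots,c_l\in\mathbb{R}^n$, $d_1,\dots,d_l\in\mathbb{R}$, $a_1,\dots,a_m\in\mathbb{R}^n$, $b_1,\dots,b_m\in\mathbb{R}$. Problem (P): minimize $x^TQ_0x+c_0^Tx$ over $x\in\mathbb{R}^n$ subject to $x^TQ_ix+c_i^Tx+d_i\le 0$ ($i=1,\dots,l$) and $a_j^Tx\le b_j$ ($j=1,\dots,m$). Let $\mathcal{C}=\{i: Q_i\succeq 0\}$, $k=|\mathcal{C}|$, $\mathcal{N}=\{1,\dots,l\}\setminus\mathcal{C}$. For $i\in\mathcal{C}$ fix $B_i\in\mathbb{R}^{n\times n}$ with $Q_i=B_i^TB_i$. For $i\in\mathcal{N}$ write $Q_i=L_i^TL_i-M_i^TM_i$, where, from a spectral decomposition of $Q_i$, the rows of $L_i$ are $\sqrt{\lambda}\,v^T$ over the positive eigenvalues $\lambda$ (orthonormal eigenvectors $v$) and the rows of $M_i$ are $\sqrt{-\lambda}\,v^T$ over the negative eigenvalues. $A\cdot B=\sum_{i,j}A_{ij}B_{ij}$, $\|\cdot\|$ is the Euclidean norm, $\|\cdot\|_F$ the Frobenius norm, $Q^{\dagger}$ the Moore-Penrose pseudoinverse. Put $p_i=\frac12Q_i^{\dagger}c_i$, $\delta_i=\frac14c_i^TQ_i^{\dagger}c_i-d_i$. $(\mathrm{SDP_{GSRT\text{-}A}})$ and $(\mathrm{SDP_{GSRT\text{-}B}})$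 have variables $x\in\mathbb{R}^n$, symmetric $X\in\mathbb{R}^{n\times n}$, $z\in\mathbb{R}^{\mathcal{N}}$, $S\in\mathbb{R}^{n\times\mathcal{N}}$ (columns $S_{\cdot,i}$), symmetric $Z\in\mathbb{R}^{\mathcal{N}\times\mathcal{N}}$, and minimize $Q_0\cdot X+c_0^Tx$ subject to: (1) $Q_i\cdot X+c_i^Tx+d_i\le0$, $i=1,\dots,l$; (2) $a_j^Tx\le b_j$, $j=1,\dots,m$; (3) $\begin{pmatrix}1&x^T&z^T\\ x&X&S\\ z&S^T&Z\end{pmatrix}\succeq0$; (4) $a_ia_j^T\cdot X+b_ib_j-b_ja_i^Tx-b_ia_j^Tx\ge0$ for all $1\le i<j\le m$; (5) for all $i\in\mathcal{C}$, $j=1,\dots,m$: $\left\|\begin{pmatrix}B_i(b_jx-Xa_j)\\ \tfrac12\left(-c_i^TXa_j+(b_jc_i^T-d_ia_j^T-a_j^T)x+(1+d_i)b_j\right)\end{pmatrix}\right\|\le\tfrac12\left(c_i^TXa_j+(d_ia_j^T-a_j^T-b_jc_i^T)x+(1-d_i)b_j\right)$; (6) for each $i\in\mathcal{N}$ and all $j=1,\dots,m$, the type A constraints (for GSRT-A) or the type B constraints (for GSRT-B) below. Type A: $\left\|\begin{pmatrix}L_ix\\ \frac12(c_i^Tx+d_i+1)\end{pmatrix}\right\|\le z_i$, $\left\|\begin{pmatrix}M_ix\\ \frac12(c_i^Tx+d_i-1)\end{pmatrix}\right\|\le z_i$, $\left\|\begin{pmatrix}L_i(b_jx-Xa_j)\\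 \frac12(c_i^T(b_jx-Xa_j)+(d_i+1)(b_j-a_j^Tx))\end{pmatrix}\right\|\le z_ib_j-S_{\cdot,i}^Ta_j$, $\left\|\begin{pmatrix}M_i(b_jx-Xa_j)\\ \frac12(c_i^T(b_jx-Xa_j)+(d_i-1)(b_j-a_j^Tx))\end{pmatrix}\right\|\le z_ib_j-S_{\cdot,i}^Ta_j$, $Z_{i,i}=X\cdot M_i^TM_i+\frac14\left(c_ic_i^T\cdot X+(d_i-1)^2+2(d_i-1)c_i^Tx\right)$. Type B: let $w_{ij}=b_jx-Xa_j+p_i(b_j-a_j^Tx)$, $\pi_i=M_i^TM_i\cdot(X+\frac14Q_i^{\dagger}c_ic_i^TQ_i^{\dagger}+Q_i^{\dagger}c_ix^T)$. If $\delta_i>0$: $\|L_i(x+p_i)\|\le z_i$, $\left\|\begin{pmatrix}M_i(x+p_i)\\ \sqrt{\delta_i}\end{pmatrix}\right\|\le z_i$, $Z_{i,i}=\pi_i+\delta_i$, $\|L_iw_{ij}\|\le z_ib_j-a_j^TS_{\cdot,i}$, $\left\|\begin{pmatrix}M_iw_{ij}\\ \sqrt{\delta_i}(b_j-a_j^Tx)\end{pmatrix}\right\|\le z_ib_j-a_j^TS_{\cdot,i}$. If $\delta_i\le0$: $\left\|\begin{pmatrix}L_i(x+p_i)\\ \sqrt{-\delta_i}\end{pmatrix}\right\|\le z_i$, $\|M_i(x+p_i)\|\le z_i$, $Z_{i,i}=\pi_i$, $\left\|\begin{pmatrix}L_iw_{ij}\\ \sqrt{-\delta_i}(b_j-a_j^Tx)\end{pmatrix}\right\|\le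 z_ib_j-a_j^TS_{\cdot,i}$, $\|M_iw_{ij}\|\le z_ib_j-a_j^TS_{\cdot,i}$. GSOC constraints: the $2l-k$ second order cone constraints $\|C^sx+\xi^s\|\le l_s(x,z)$, $s=1,\dots,2l-k$, with $l_s(x,z)=(\zeta^s)^Tx+(\eta^s)^Tz+\theta^s$ ($\zeta^s\in\mathbb{R}^n$, $\eta^s\in\mathbb{R}^{\mathcal{N}}$, $\theta^s\in\mathbb{R}$), are obtained as follows. Each $i\in\mathcal{C}$ contributes one: $\left\|\begin{pmatrix}B_ix\\ \frac12(-d_i-c_i^Tx-1)\end{pmatrix}\right\|\le\frac12(-d_i-c_i^Tx+1)$, or alternatively, if $c_i\in\mathrm{Range}(Q_i)$ and $\delta_i\ge0$, $\|B_i(x+p_i)\|\le\sqrt{\delta_i}$. Each $i\in\mathcal{N}$ contributes two: the first two (second order cone, bounded by $z_i$) constraints in the type A list, respectively in the applicable case of the type B list, according to whether $R$ comes from GSRT-A or GSRT-B. Here $C^s$ and $\xi^s$ are the matrix and constant vector such that the vector inside the norm equals $C^sx+\xi^s$. *)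

(* Defs.v *)
From HB Require Import structures.
From mathcomp Require Import all_boot all_order all_algebra.
From mathcomp Require Import zify.
From mathcomp Require Import boolp classical_sets reals constructive_ereal ereal.

Set Implicit Arguments.
Unset Strict Implicit.
Unset Printing Implicit Defensive.

Import Order.TTheory GRing.Theory Num.Theory.
Local Open Scope ring_scope.

(* u^T v for column vectors. *)
Definition dot {R : realType} {n : nat} (u v : 'cV[R]_n) : R :=
  \sum_(i < n) u i ord0 * v i ord0.

(* A . B, the trace inner product. *)
Definition mdot {R : realType} {p q : nat} (A B : 'M[R]_(p, q)) : R :=
  \sum_(i < p) \sum_(j < q) A i j * B i j.

(* The library norm `|v| of a matrix is the max norm, hence these two. *)
Definition enorm {R : realType} {n : nat} (v : 'cV[R]_n) : R :=
  Num.sqrt (\sum_(i < n) v i ord0 ^+ 2).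

Definition fnorm {R : realType} {p q : nat} (A : 'M[R]_(p, q)) : R :=
  Num.sqrt (\sum_(i < p) \sum_(j < q) A i j ^+ 2).

(* The vector v with the scalar s appended. *)
Definition vcons {R : realType} {n : nat} (v : 'cV[R]_n) (s : R) :
    'cV[R]_(n + 1) :=
  col_mx v s%:M.

Definition psd {R : realType} {n : nat} (A : 'M[R]_n) : Prop :=
  A^T = A /\ forall y : 'cV[R]_n, 0 <= dot y (A *m y).

Definition in_range {R : realType} {n : nat} (A : 'M[R]_n) (v : 'cV[R]_n) :
    Prop :=
  exists y : 'cV[R]_n, v = A *m y.

(* The four Penrose equations. *)
Definition is_mp_inverse {R : realType} {n : nat} (A P : 'M[R]_n) : Prop :=
  [/\ A *m P *m A = A, P *m A *m P = P,
      (A *m P)^T = A *m P & (P *m A)^T = P *m A].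

(* xget returns the (unique) matrix satisfying the Penrose equations;
   the library's pinvmx is only some partial inverse. *)
Definition mp_inverse {R : realType} {n : nat} (A : 'M[R]_n) : 'M[R]_n :=
  xget 0 (is_mp_inverse A : set 'M[R]_n).

(* The rows of V are orthonormal eigenvectors of A, with eigenvalues lam. *)
Definition spectral_dec {R : realType} {n : nat} (A V : 'M[R]_n)
    (lam : 'rV[R]_n) : Prop :=
  V *m V^T = 1%:M /\ A = V^T *m diag_mx lam *m V.

(* Rows sqrt(lam_a) v_a^T over the positive eigenvalues. *)
Definition pos_factor {R : realType} {n : nat} (V : 'M[R]_n) (lam : 'rV[R]_n) :
    'M[R]_(#|[set a | 0 < lam ord0 a]%SET|, n) :=
  \matrix_(a, j) (Num.sqrt (lam ord0 (enum_val a)) * V (enum_val a) j).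

(* Rows sqrt(-lam_a) v_a^T over the negative eigenvalues. *)
Definition neg_factor {R : realType} {n : nat} (V : 'M[R]_n) (lam : 'rV[R]_n) :
    'M[R]_(#|[set a | lam ord0 a < 0]%SET|, n) :=
  \matrix_(a, j) (Num.sqrt (- lam ord0 (enum_val a)) * V (enum_val a) j).

(* Problem data; the indices 1..l and 1..m become 0..l-1 and 0..m-1, and the
   objective data Q_0, c_0 are separate fields. *)
Record qcqp (R : realType) (n l m : nat) := Qcqp {
  qQ0 : 'M[R]_n;
  qc0 : 'cV[R]_n;
  qQ : 'I_l -> 'M[R]_n;
  qc : 'I_l -> 'cV[R]_n;
  qd : 'I_l -> R;
  qa : 'I_m -> 'cV[R]_n;
  qb : 'I_m -> R }.

Definition qcqp_wf {R : realType} {n l m : nat} (D : qcqp R n l m) : Prop :=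
  (qQ0 D)^T = qQ0 D /\ forall i : 'I_l, (qQ D i)^T = qQ D i /\ qQ D i != 0.

Definition P_feasible {R : realType} {n l m : nat} (D : qcqp R n l m) :
    set 'cV[R]_n :=
  fun x => (forall i, dot x (qQ D i *m x) + dot (qc D i) x + qd D i <= 0)
        /\ (forall j, dot (qa D j) x <= qb D j).

Definition P_val {R : realType} {n l m : nat} (D : qcqp R n l m) : \bar R :=
  ereal_inf [set (dot x (qQ0 D *m x) + dot (qc0 D) x)%:E |
              x in P_feasible D]%classic.

Definition cvx {R : realType} {n l m : nat} (D : qcqp R n l m) : {set 'I_l} :=
  [set i | `[< psd (qQ D i) >]]%SET.

Definition ncvx {R : realType} {n l m : nat} (D : qcqp R n l m) : {set 'I_l} :=
  (~: cvx D)%SET.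

(* R^N is 'cV[R]_(nn D); position r stands for the index nidx r of N. *)
Definition nn {R : realType} {n l m : nat} (D : qcqp R n l m) : nat :=
  #|ncvx D|.

Definition nidx {R : realType} {n l m : nat} {D : qcqp R n l m}
    (r : 'I_(nn D)) : 'I_l :=
  enum_val r.

(* fB i is B_i, used for i in C only; eigV i and eigl i are a spectral
   decomposition of Q_i, used for i in N only. *)
Record factors (R : realType) (n l : nat) := Factors {
  fB : 'I_l -> 'M[R]_n;
  eigV : 'I_l -> 'M[R]_n;
  eigl : 'I_l -> 'rV[R]_n }.

Definition factors_wf {R : realType} {n l m : nat} (D : qcqp R n l m)
    (F : factors R n l) : Prop :=
  (forall i, i \in cvx D -> qQ D i = (fB F i)^T *m fB F i)
  /\ (forall i, i \in ncvx D -> spectral_dec (qQ D i) (eigV F i) (eigl F i)).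

Definition fL {R : realType} {n l : nat} (F : factors R n l) (i : 'I_l) :=
  pos_factor (eigV F i) (eigl F i).

Definition fM {R : realType} {n l : nat} (F : factors R n l) (i : 'I_l) :=
  neg_factor (eigV F i) (eigl F i).

(* Q_i^dagger. *)
Definition Qd {R : realType} {n l m : nat} (D : qcqp R n l m) (i : 'I_l) :
    'M[R]_n :=
  mp_inverse (qQ D i).

Definition pshift {R : realType} {n l m : nat} (D : qcqp R n l m) (i : 'I_l) :
    'cV[R]_n :=
  2^-1 *: (Qd D i *m qc D i).

Definition delta {R : realType} {n l m : nat} (D : qcqp R n l m) (i : 'I_l) :
    R :=
  4^-1 * dot (qc D i) (Qd D i *m qc D i) - qd D i.

(* Points (x, X, z, S, Z) of the lifted space; q = |N|. *)
Record lifted (R : realType) (n q : nat) := Lifted {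
  lx : 'cV[R]_n;
  lX : 'M[R]_n;
  lz : 'cV[R]_q;
  lS : 'M[R]_(n, q);
  lZ : 'M[R]_q }.

Definition lift_mx {R : realType} {n q : nat} (pt : lifted R n q) :
    'M[R]_(1 + (n + q)) :=
  block_mx (1%:M : 'M[R]_1) (row_mx (lx pt)^T (lz pt)^T)
           (col_mx (lx pt) (lz pt))
           (block_mx (lX pt) (lS pt) (lS pt)^T (lZ pt)).

(* Constraints (1)-(5), common to both relaxations. *)
Definition base_constraints {R : realType} {n l m : nat} (D : qcqp R n l m)
    (F : factors R n l) (pt : lifted R n (nn D)) : Prop :=
  let x := lx pt in
  let X := lX pt in
  [/\ forall i, mdot (qQ D i) X + dot (qc D i) x + qd D i <= 0,
      forall j, dot (qa D j) x <= qb D j,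
      psd (lift_mx pt),
      forall i j : 'I_m, (i < j)%N ->
        0 <= mdot (qa D i *m (qa D j)^T) X + qb D i * qb D j
             - qb D j * dot (qa D i) x - qb D i * dot (qa D j) x
    & forall (i : 'I_l) (j : 'I_m), i \in cvx D ->
        enorm (vcons (fB F i *m (qb D j *: x - X *m qa D j))
          (2^-1 * (- dot (qc D i) (X *m qa D j)
                   + dot (qb D j *: qc D i - qd D i *: qa D j - qa D j) x
                   + (1 + qd D i) * qb D j)))
        <= 2^-1 * (dot (qc D i) (X *m qa D j)
                   + dot (qd D i *: qa D j - qa D j - qb D j *: qc D i) x
                   + (1 - qd D i) * qb D j)].

(* The type A constraints of index nidx r: the ones not involving j, then
   the ones for each j. *)
Definition typeA_constraints {R : realType} {n l m : nat} (D : qcqp R n l m)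
    (F : factors R n l) (pt : lifted R n (nn D)) (r : 'I_(nn D)) : Prop :=
  let i := nidx r in
  let x := lx pt in
  let X := lX pt in
  let zi := lz pt r ord0 in
  let u := fun j => qb D j *: x - X *m qa D j in
  let t := fun j => qb D j - dot (qa D j) x in
  let rhs := fun j => zi * qb D j - dot (col r (lS pt)) (qa D j) in
  [/\ enorm (vcons (fL F i *m x) (2^-1 * (dot (qc D i) x + qd D i + 1))) <= zi,
      enorm (vcons (fM F i *m x) (2^-1 * (dot (qc D i) x + qd D i - 1))) <= zi,
      lZ pt r r = mdot X ((fM F i)^T *m fM F i)
        + 4^-1 * (mdot (qc D i *m (qc D i)^T) X + (qd D i - 1) ^+ 2
                  + 2 * (qd D i - 1) * dot (qc D i) x),
      forall j : 'I_m, enorm (vcons (fL F i *m u j)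
        (2^-1 * (dot (qc D i) (u j) + (qd D i + 1) * t j))) <= rhs j
    & forall j : 'I_m, enorm (vcons (fM F i *m u j)
        (2^-1 * (dot (qc D i) (u j) + (qd D i - 1) * t j))) <= rhs j].

Definition typeB_constraints {R : realType} {n l m : nat} (D : qcqp R n l m)
    (F : factors R n l) (pt : lifted R n (nn D)) (r : 'I_(nn D)) : Prop :=
  let i := nidx r in
  let x := lx pt in
  let X := lX pt in
  let zi := lz pt r ord0 in
  let t := fun j => qb D j - dot (qa D j) x in
  let w := fun j => qb D j *: x - X *m qa D j + t j *: pshift D i in
  let ppi := mdot ((fM F i)^T *m fM F i)
               (X + 4^-1 *: (Qd D i *m qc D i *m (qc D i)^T *m Qd D i)
                + Qd D i *m qc D i *m x^T) in
  let rhs := fun j => zi * qb D j - dot (qa D j) (col r (lS pt)) in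
  if 0 < delta D i then
    [/\ enorm (fL F i *m (x + pshift D i)) <= zi,
        enorm (vcons (fM F i *m (x + pshift D i)) (Num.sqrt (delta D i)))
          <= zi,
        lZ pt r r = ppi + delta D i,
        forall j : 'I_m, enorm (fL F i *m w j) <= rhs j
      & forall j : 'I_m,
          enorm (vcons (fM F i *m w j) (Num.sqrt (delta D i) * t j)) <= rhs j]
  else
    [/\ enorm (vcons (fL F i *m (x + pshift D i)) (Num.sqrt (- delta D i)))
          <= zi,
        enorm (fM F i *m (x + pshift D i)) <= zi,
        lZ pt r r = ppi,
        forall j : 'I_m,
          enorm (vcons (fL F i *m w j) (Num.sqrt (- delta D i) * t j)) <= rhs j
      & forall j : 'I_m, enorm (fM F i *m w j) <= rhs j].

Inductive gsrt_type := TypeA | TypeB.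

Definition gsrt_feasible {R : realType} {n l m : nat} (D : qcqp R n l m)
    (F : factors R n l) (ty : gsrt_type) : set (lifted R n (nn D)) :=
  fun pt => [/\ (lX pt)^T = lX pt, (lZ pt)^T = lZ pt, base_constraints F pt
    & forall r : 'I_(nn D),
        match ty with
        | TypeA => typeA_constraints F pt r
        | TypeB => typeB_constraints F pt r
        end].

(* The constraint || C x + xi || <= zeta^T x + eta^T z + theta. *)
Record soc (R : realType) (n q : nat) := Soc {
  sdim : nat;
  sC : 'M[R]_(sdim, n);
  sxi : 'cV[R]_sdim;
  szeta : 'cV[R]_n;
  seta : 'cV[R]_q;
  stheta : R }.

Definition unitv {R : realType} {q : nat} (r : 'I_q) : 'cV[R]_q :=
  delta_mx r ord0.

(* alt is the set of those i in C for which the form |B_i (x + p_i)| <=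
   sqrt delta_i is chosen; see alt_ok for when this is allowed. *)
Definition soc_cvx {R : realType} {n l m : nat} (D : qcqp R n l m)
    (F : factors R n l) (alt : {set 'I_l}) (i : 'I_l) : soc R n (nn D) :=
  if i \in alt then
    Soc (fB F i) (fB F i *m pshift D i) 0 0 (Num.sqrt (delta D i))
  else
    Soc (col_mx (fB F i) (- (2^-1 *: (qc D i)^T)))
        (vcons 0 (2^-1 * (- qd D i - 1)))
        (- (2^-1 *: qc D i)) 0 (2^-1 * (1 - qd D i)).

(* For i in N: C x + xi is the vector in the norm of the first, resp. second,
   type A or type B constraint, and the right-hand side is z_i. *)
Definition socA1 {R : realType} {n l m : nat} (D : qcqp R n l m)
    (F : factors R n l) (r : 'I_(nn D)) : soc R n (nn D) :=
  let i := nidx r in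
  Soc (col_mx (fL F i) (2^-1 *: (qc D i)^T)) (vcons 0 (2^-1 * (qd D i + 1)))
      0 (unitv r) 0.

Definition socA2 {R : realType} {n l m : nat} (D : qcqp R n l m)
    (F : factors R n l) (r : 'I_(nn D)) : soc R n (nn D) :=
  let i := nidx r in
  Soc (col_mx (fM F i) (2^-1 *: (qc D i)^T)) (vcons 0 (2^-1 * (qd D i - 1)))
      0 (unitv r) 0.

Definition socB1 {R : realType} {n l m : nat} (D : qcqp R n l m)
    (F : factors R n l) (r : 'I_(nn D)) : soc R n (nn D) :=
  let i := nidx r in
  if 0 < delta D i then Soc (fL F i) (fL F i *m pshift D i) 0 (unitv r) 0
  else Soc (col_mx (fL F i) (0 : 'rV[R]_n))
           (vcons (fL F i *m pshift D i) (Num.sqrt (- delta D i))) 0 (unitv r) 0.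

Definition socB2 {R : realType} {n l m : nat} (D : qcqp R n l m)
    (F : factors R n l) (r : 'I_(nn D)) : soc R n (nn D) :=
  let i := nidx r in
  if 0 < delta D i then
    Soc (col_mx (fM F i) (0 : 'rV[R]_n))
        (vcons (fM F i *m pshift D i) (Num.sqrt (delta D i))) 0 (unitv r) 0
  else Soc (fM F i) (fM F i *m pshift D i) 0 (unitv r) 0.

Definition soc1 {R : realType} {n l m : nat} (D : qcqp R n l m)
    (F : factors R n l) (ty : gsrt_type) : 'I_(nn D) -> soc R n (nn D) :=
  if ty is TypeA then socA1 F else socB1 F.

Definition soc2 {R : realType} {n l m : nat} (D : qcqp R n l m)
    (F : factors R n l) (ty : gsrt_type) : 'I_(nn D) -> soc R n (nn D) :=
  if ty is TypeA then socA2 F else socB2 F.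

Definition gsoc_seq {R : realType} {n l m : nat} (D : qcqp R n l m)
    (F : factors R n l) (ty : gsrt_type) (alt : {set 'I_l}) :
    seq (soc R n (nn D)) :=
  [seq soc_cvx D F alt i | i <- enum (cvx D)]
  ++ [seq soc1 F ty r | r <- enum 'I_(nn D)]
  ++ [seq soc2 F ty r | r <- enum 'I_(nn D)].

Lemma size_gsoc_seq {R : realType} {n l m : nat} (D : qcqp R n l m)
    (F : factors R n l) (ty : gsrt_type) (alt : {set 'I_l}) :
  size (gsoc_seq D F ty alt) == (2 * l - #|cvx D|)%N.
Proof.
have e : (#|cvx D| + nn D)%N = l by rewrite /nn cardsC card_ord.
rewrite /gsoc_seq !size_cat !size_map -!enumT -!cardE card_ord.
by move: #|cvx D| (nn D) e => k q e; lia.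
Qed.

(* The 2l - k GSOC constraints.  Their numbering is immaterial: the SST
   constraint of the pair (s, t) is symmetric in s, t when X and Z are. *)
Definition gsoc {R : realType} {n l m : nat} (D : qcqp R n l m)
    (F : factors R n l) (ty : gsrt_type) (alt : {set 'I_l}) :
    (2 * l - #|cvx D|).-tuple (soc R n (nn D)) :=
  Tuple (size_gsoc_seq D F ty alt).

Definition alt_ok {R : realType} {n l m : nat} (D : qcqp R n l m)
    (alt : {set 'I_l}) : Prop :=
  forall i, i \in alt ->
    [/\ i \in cvx D, in_range (qQ D i) (qc D i) & 0 <= delta D i].

Definition sst_beta {R : realType} {n q : nat} (pt : lifted R n q)
    (s t : soc R n q) : R :=
  dot (szeta s) (lX pt *m szeta t) + dot (szeta s) (lS pt *m seta t)
  + dot (szeta t) (lS pt *m seta s) + dot (seta s) (lZ pt *m seta t)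
  + dot (stheta s *: szeta t + stheta t *: szeta s) (lx pt)
  + dot (stheta s *: seta t + stheta t *: seta s) (lz pt)
  + stheta s * stheta t.

Definition sst {R : realType} {n q : nat} (pt : lifted R n q)
    (s t : soc R n q) : Prop :=
  fnorm (sC s *m lX pt *m (sC t)^T + sC s *m lx pt *m (sxi t)^T
         + sxi s *m (lx pt)^T *m (sC t)^T + sxi s *m (sxi t)^T)
  <= sst_beta pt s t.

Definition gsrt_sst_feasible {R : realType} {n l m : nat} (D : qcqp R n l m)
    (F : factors R n l) (ty : gsrt_type) (alt : {set 'I_l}) :
    set (lifted R n (nn D)) :=
  fun pt => gsrt_feasible F ty pt
    /\ forall s t : 'I_(2 * l - #|cvx D|), (s < t)%N ->
         sst pt (tnth (gsoc D F ty alt) s) (tnth (gsoc D F ty alt) t).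

(* Optimal value of minimizing Q_0 . X + c_0^T x over A. *)
Definition sdp_val {R : realType} {n l m : nat} (D : qcqp R n l m)
    (A : set (lifted R n (nn D))) : \bar R :=
  ereal_inf [set (mdot (qQ0 D) (lX pt) + dot (qc0 D) (lx pt))%:E |
              pt in A]%classic.

(* Main.v *)
Require Import Defs.
From mathcomp Require Import all_boot all_order all_algebra.
From mathcomp Require Import boolp classical_sets reals constructive_ereal ereal.
From mathcomp Require Import ring lra.

(** The second inequality holds because the SST constraints only shrink the
    feasible set.  For the first, every feasible [x] of the quadratic problem
    is lifted to the rank-one point [X = x x^T], [S = x z^T], [Z = z z^T],
    which has the same objective value, for a suitable [z]; it remains to see
    that this point satisfies all constraints ([rank1_lift_feasible]).

    The choice of [z] is forced: the relaxation prescribes [Z r r], which is to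
    be [z r ^ 2], and the prescribed value turns out to be the squared norm of
    the second of the two cone vectors attached to the nonconvex index [r].  So
    [z r] is taken to be that norm ([zlift]), and the second cone constraint
    holds with equality.  The difference of the squared norms of the first and
    the second cone vector is the value at [x] of the original quadratic
    constraint ([soc_gap]), which is nonpositive, whence the first cone
    constraint.  In type A this is a difference of squares applied to the
    affine part; in type B it is completion of the square, which requires that
    the pseudoinverse exist ([mp_inverseP]) and that [c] lie in the range of
    [Q] ([complete_square]), while the prescribed [Z r r] takes the expected
    form because the pseudoinverse of a symmetric matrix is symmetric
    ([trmx_mp_inverse]).

    The other constraints of the lifted problem are products of valid
    inequalities in [x] and [z], linearized by [X], [S], [Z], and are hence
    satisfied at a rank-one point: the factors are two linear constraints, or
    a cone constraint and the slack of a linear one ([enorm_scale_le]), or,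
    for SST, two cone constraints ([sst_rank1]). *)

Set Implicit Arguments.
Unset Strict Implicit.
Unset Printing Implicit Defensive.

Import Order.TTheory GRing.Theory Num.Theory.
Local Open Scope ring_scope.

(** * Inner products and norms *)

Section InnerProduct.
Context {R : realType}.
Implicit Types n p q : nat.

Lemma dotE n (u v : 'cV[R]_n) : dot u v = (u^T *m v) ord0 ord0.
Proof. by rewrite mxE; apply: eq_bigr => i _; rewrite mxE. Qed.

Lemma dotC n (u v : 'cV[R]_n) : dot u v = dot v u.
Proof. by apply: eq_bigr => i _; rewrite mulrC. Qed.

Lemma dotDl n (u v w : 'cV[R]_n) : dot (u + v) w = dot u w + dot v w.
Proof. by rewrite -big_split; apply: eq_bigr => i _; rewrite mxE mulrDl. Qed.

Lemma dotZl n (k : R) (u w : 'cV[R]_n) : dot (k *: u) w = k * dot u w.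
Proof. by rewrite /dot big_distrr; apply: eq_bigr => i _ /=; rewrite mxE mulrA. Qed.

Lemma dotNl n (u w : 'cV[R]_n) : dot (- u) w = - dot u w.
Proof. by rewrite -scaleN1r dotZl mulN1r. Qed.

Lemma dotDr n (u v w : 'cV[R]_n) : dot w (u + v) = dot w u + dot w v.
Proof. by rewrite dotC dotDl !(dotC w). Qed.

Lemma dotZr n (k : R) (u w : 'cV[R]_n) : dot w (k *: u) = k * dot w u.
Proof. by rewrite dotC dotZl dotC. Qed.

Lemma dotNr n (u w : 'cV[R]_n) : dot w (- u) = - dot w u.
Proof. by rewrite dotC dotNl dotC. Qed.

Lemma dot0l n (u : 'cV[R]_n) : dot 0 u = 0.
Proof. by rewrite -(scale0r 0) dotZl mul0r. Qed.

Lemma dot0r n (u : 'cV[R]_n) : dot u 0 = 0.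
Proof. by rewrite dotC dot0l. Qed.

Definition dotlin := (dotDl, dotDr, dotNl, dotNr, dotZl, dotZr, @dot0l, @dot0r).

Lemma dot_mulmxr p q (A : 'M[R]_(p, q)) (u : 'cV[R]_p) (v : 'cV[R]_q) :
  dot u (A *m v) = dot (A^T *m u) v.
Proof. by rewrite !dotE trmx_mul trmxK mulmxA. Qed.

Lemma dot_col_mx p q (u u' : 'cV[R]_p) (v v' : 'cV[R]_q) :
  dot (col_mx u v) (col_mx u' v') = dot u u' + dot v v'.
Proof. by rewrite !dotE tr_col_mx mul_row_col mxE. Qed.

Lemma dot_scalar_mx (s t : R) : dot (s%:M : 'cV[R]_1) t%:M = s * t.
Proof. by rewrite /dot big_ord1 !mxE. Qed.

Lemma dot_vcons n (u v : 'cV[R]_n) s t :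
  dot (vcons u s) (vcons v t) = dot u v + s * t.
Proof. by rewrite dot_col_mx dot_scalar_mx. Qed.

Lemma dot_unitv n (r : 'I_n) (z : 'cV[R]_n) : dot (unitv r) z = z r ord0.
Proof.
rewrite /dot (bigD1 r) //= big1 ?addr0 => [|i nir]; rewrite !mxE ?eqxx ?mul1r //.
by rewrite (negbTE nir) mul0r.
Qed.

Lemma dot_ge0 n (u : 'cV[R]_n) : 0 <= dot u u.
Proof. by apply: sumr_ge0 => i _; rewrite -expr2 sqr_ge0. Qed.

Lemma enormE n (u : 'cV[R]_n) : enorm u = Num.sqrt (dot u u).
Proof. by congr Num.sqrt; apply: eq_bigr => i _; rewrite expr2. Qed.

Lemma enorm_ge0 n (u : 'cV[R]_n) : 0 <= enorm u.
Proof. exact: sqrtr_ge0. Qed.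

Lemma sqr_enorm n (u : 'cV[R]_n) : enorm u ^+ 2 = dot u u.
Proof. by rewrite enormE sqr_sqrtr ?dot_ge0. Qed.

Lemma enormZ n (k : R) (u : 'cV[R]_n) : 0 <= k -> enorm (k *: u) = k * enorm u.
Proof.
move=> k0; rewrite !enormE dotZl dotZr mulrA -expr2.
by rewrite sqrtrM ?sqr_ge0 // sqrtr_sqr ger0_norm.
Qed.

Lemma enorm_le n (u : 'cV[R]_n) (k : R) :
  0 <= k -> dot u u <= k ^+ 2 -> enorm u <= k.
Proof.
move=> k0 h; rewrite -(@ler_pXn2r _ 2%N) ?nnegrE ?enorm_ge0 //.
by rewrite sqr_enorm.
Qed.

Lemma scale_vcons n (k s : R) (u : 'cV[R]_n) :
  k *: vcons u s = vcons (k *: u) (k * s).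
Proof. by rewrite /vcons scale_col_mx scale_scalar_mx. Qed.

Lemma enorm_vconsN n (u : 'cV[R]_n) s : enorm (vcons u (- s)) = enorm (vcons u s).
Proof. by rewrite !enormE !dot_vcons mulrNN. Qed.

Lemma mulmx_outer n p (u : 'cV[R]_n) (v w : 'cV[R]_p) :
  u *m v^T *m w = dot v w *: u.
Proof.
by rewrite -mulmxA [v^T *m w]mx11_scalar -dotE mul_mx_scalar.
Qed.

Lemma mdotC p q (A B : 'M[R]_(p, q)) : mdot A B = mdot B A.
Proof. by apply: eq_bigr => i _; apply: eq_bigr => j _; rewrite mulrC. Qed.

Lemma mdot_outer p q (A : 'M[R]_(p, q)) u v : mdot A (u *m v^T) = dot u (A *m v).
Proof.
apply: eq_bigr => i _; rewrite [(A *m v) i _]mxE big_distrr; apply: eq_bigr => j _ /=.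
by rewrite mxE big_ord1 [_^T _ _]mxE; ring.
Qed.

Lemma mdotDr p q (A B C : 'M[R]_(p, q)) : mdot A (B + C) = mdot A B + mdot A C.
Proof.
rewrite -big_split; apply: eq_bigr => i _ /=.
by rewrite -big_split; apply: eq_bigr => j _ /=; rewrite mxE mulrDr.
Qed.

Lemma mdotZr p q k (A B : 'M[R]_(p, q)) : mdot A (k *: B) = k * mdot A B.
Proof.
rewrite big_distrr; apply: eq_bigr => i _ /=.
by rewrite big_distrr; apply: eq_bigr => j _ /=; rewrite mxE; ring.
Qed.

Lemma fnorm_outer p q (u : 'cV[R]_p) (v : 'cV[R]_q) :
  fnorm (u *m v^T) = enorm u * enorm v.
Proof.
rewrite !enormE -sqrtrM ?dot_ge0 // /dot big_distrl; congr Num.sqrt.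
apply: eq_bigr => i _; rewrite big_distrr; apply: eq_bigr => j _ /=.
by rewrite mxE big_ord1 [_^T _ _]mxE; ring.
Qed.

Lemma psd_outer n (u : 'cV[R]_n) : psd (u *m u^T).
Proof.
split=> [|y]; first by rewrite trmx_mul trmxK.
by rewrite mulmx_outer dotZr (dotC y) -expr2 sqr_ge0.
Qed.

End InnerProduct.

(** * The Moore-Penrose inverse *)

(** Over an ordered field [B B^T] has the kernel of [B], a sum of squares
    vanishing only if each term does. *)
Lemma gram_unit (R : realFieldType) (p q : nat) (B : 'M[R]_(p, q)) :
  row_free B -> B *m B^T \in unitmx.
Proof.
move=> freeB; rewrite -row_free_unit; apply: inj_row_free => u u0.
have : (u *m B) *m (u *m B)^T = 0 by rewrite trmx_mul !mulmxA -(mulmxA u) u0 mul0mx.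
move/matrixP/(_ ord0 ord0); rewrite [LHS]mxE mxE => s0.
apply: (row_free_inj freeB); rewrite mul0mx; apply/rowP => j; rewrite [RHS]mxE.
have sq_ge0 i : true -> 0 <= (u *m B) ord0 i * (u *m B)^T i ord0.
  by rewrite [_^T _ _]mxE -expr2 sqr_ge0.
have /eqP := psumr_eq0P sq_ge0 s0 (i := j) isT.
by rewrite [_^T _ _]mxE -expr2 sqrf_eq0 => /eqP.
Qed.

Section MoorePenrose.
Context {R : realType} {n : nat}.
Implicit Types A P : 'M[R]_n.

(** The classical formula for the pseudoinverse from a full-rank factorization;
    the products of [C B] with it are the orthogonal projections onto the
    column space of [C] and onto the row space of [B]. *)
Lemma is_mp_inverse_mulmx r (C : 'M[R]_(n, r)) (B : 'M[R]_(r, n)) :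
  row_free C^T -> row_free B ->
  is_mp_inverse (C *m B)
    (B^T *m invmx (B *m B^T) *m invmx (C^T *m C) *m C^T).
Proof.
move=> /gram_unit; rewrite trmxK => uC /gram_unit uB.
set G := invmx (B *m B^T); set H := invmx (C^T *m C).
have tG : G^T = G by rewrite /G trmx_inv trmx_mul trmxK.
have tH : H^T = H by rewrite /H trmx_inv trmx_mul trmxK.
have AP : C *m B *m (B^T *m G *m H *m C^T) = C *m H *m C^T.
  by rewrite !mulmxA -(mulmxA C B) -(mulmxA C _ G) mulmxV ?mulmx1.
have PA : B^T *m G *m H *m C^T *m (C *m B) = B^T *m G *m B.
  by rewrite !mulmxA -(mulmxA _ C^T C) -(mulmxA _ H) mulVmx ?mulmx1.
split.
- by rewrite AP !mulmxA -(mulmxA _ C^T C) -(mulmxA _ H) mulVmx ?mulmx1.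
- by rewrite PA !mulmxA -(mulmxA _ B B^T) -(mulmxA _ (_ *m _) G) mulmxV ?mulmx1.
- by rewrite AP !trmx_mul trmxK tH mulmxA.
- by rewrite PA !trmx_mul trmxK tG mulmxA.
Qed.

Lemma is_mp_inverse_exists A : exists P, is_mp_inverse A P.
Proof.
rewrite -(mulmx_base A); eexists; apply: is_mp_inverse_mulmx.
  by rewrite /row_free mxrank_tr; apply: col_base_full.
exact: row_base_free.
Qed.

(** [A P] and [A P'] are symmetric and each absorbs the other on the left,
    so transposing one absorption identity makes them equal. *)
Lemma is_mp_inverse_inj A P P' : is_mp_inverse A P -> is_mp_inverse A P' -> P = P'.
Proof.
move=> [h1 h2 h3 h4] [k1 k2 k3 k4].
have AP : A *m P = A *m P'.
  have e : A *m P' = (A *m P) *m (A *m P') by rewrite mulmxA h1.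
  have e' : A *m P = (A *m P') *m (A *m P) by rewrite mulmxA k1.
  by rewrite e' -[LHS]trmxK trmx_mul h3 k3 -e k3.
have PA : P *m A = P' *m A.
  have e : P' *m A = (P' *m A) *m (P *m A) by rewrite -mulmxA (mulmxA A) h1.
  have e' : P *m A = (P *m A) *m (P' *m A) by rewrite -mulmxA (mulmxA A) k1.
  by rewrite e' -[LHS]trmxK trmx_mul h4 k4 -e k4.
by rewrite -h2 -mulmxA AP mulmxA PA k2.
Qed.

Lemma mp_inverseP A : is_mp_inverse A (mp_inverse A).
Proof. by have [P hP] := is_mp_inverse_exists A; apply: (xgetPex 0); exists P. Qed.

(** By uniqueness: transposition maps pseudoinverses of [A] to pseudoinverses
    of [A^T]. *)
Lemma trmx_mp_inverse A : A^T = A -> (mp_inverse A)^T = mp_inverse A.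
Proof.
move=> tA; have [h1 h2 h3 h4] := mp_inverseP A; apply: (@is_mp_inverse_inj A).
  have AP : A *m (mp_inverse A)^T = mp_inverse A *m A by rewrite -h4 trmx_mul tA.
  have PA : (mp_inverse A)^T *m A = A *m mp_inverse A by rewrite -h3 trmx_mul tA.
  split; rewrite ?AP ?PA //.
  - by rewrite -[RHS]tA -[in RHS]h1 !trmx_mul tA mulmxA AP.
  - by rewrite -[in RHS]h2 !trmx_mul tA mulmxA PA.
exact: mp_inverseP.
Qed.

End MoorePenrose.

(** * Quadratic forms *)

Section QuadraticForms.
Context {R : realType} {n : nat}.

Lemma dot_scaled_rows (V : 'M[R]_n) (sg : 'I_n -> R) (S : {set 'I_n}) x :
  let W := \matrix_(a < #|S|, j < n) (sg (enum_val a) * V (enum_val a) j) in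
  dot (W *m x) (W *m x) = \sum_(a in S) sg a ^+ 2 * (V *m x) a ord0 ^+ 2.
Proof.
rewrite big_enum_val; apply: eq_bigr => a _; rewrite -expr2 -exprMn.
congr (_ ^+ 2); rewrite !mxE big_distrr; apply: eq_bigr => j _ /=.
by rewrite mxE mulrA.
Qed.

(** In the coordinates [V *m x] the form is the sum of [lam a] times squares,
    and the two factors collect its positive and its negative terms. *)
Lemma spectral_dec_form (A V : 'M[R]_n) lam x : spectral_dec A V lam ->
  dot x (A *m x) = dot (pos_factor V lam *m x) (pos_factor V lam *m x)
                   - dot (neg_factor V lam *m x) (neg_factor V lam *m x).
Proof.
move=> [_ ->]; set y := V *m x.
have -> : dot x (V^T *m diag_mx lam *m V *m x)
          = \sum_a lam ord0 a * y a ord0 ^+ 2.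
  rewrite -!mulmxA dot_mulmxr trmxK -/y; apply: eq_bigr => a _.
  by rewrite mul_diag_mx [X in _ * X]mxE; ring.
rewrite (dot_scaled_rows _ (fun a => Num.sqrt (lam ord0 a))).
rewrite (dot_scaled_rows _ (fun a => Num.sqrt (- lam ord0 a))).
rewrite [X in X - _]big_mkcond [X in _ - X]big_mkcond -sumrB; apply: eq_bigr => a _ /=.
rewrite !inE -/y; case: ltrgtP => [a0|a0|<-]; last by ring.
  by rewrite sqr_sqrtr ?ltW //; ring.
by rewrite sqr_sqrtr ?oppr_ge0 ?ltW //; ring.
Qed.

(** The pseudoinverse yields a centre [- p] of the quadric, [2 Q p = c],
    exactly because [c] lies in the range of [Q]: there [Q Q^+] is the
    identity. *)
Lemma complete_square (Q : 'M[R]_n) (c x : 'cV[R]_n) (e : R) :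
  Q^T = Q -> in_range Q c ->
  let p := 2^-1 *: (mp_inverse Q *m c) in
  dot (x + p) (Q *m (x + p))
  = dot x (Q *m x) + dot c x + e
    + (4^-1 * dot c (mp_inverse Q *m c) - e).
Proof.
move=> tQ [y cE] p; have [h1 _ _ _] := mp_inverseP Q.
have Qp : Q *m p = 2^-1 *: c by rewrite -scalemxAr mulmxA cE mulmxA h1.
have xQp : dot p (Q *m x) = 2^-1 * dot c x by rewrite dot_mulmxr tQ Qp dotlin.
have pc : dot p c = 2^-1 * dot c (mp_inverse Q *m c) by rewrite dotZl dotC.
rewrite mulmxDr !dotDl !dotDr xQp Qp !dotZr pc (dotC x c).
by field.
Qed.

Lemma dot_gram q (B : 'M[R]_(q, n)) (x y : 'cV[R]_n) :
  dot x (B^T *m B *m y) = dot (B *m x) (B *m y).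
Proof. by rewrite -mulmxA dot_mulmxr trmxK. Qed.

End QuadraticForms.

(** * Second order cone constraints and their products *)

Section SecondOrderCone.
Context {R : realType} {n q : nat}.
Implicit Types (s t : soc R n q) (x : 'cV[R]_n) (z : 'cV[R]_q).

Definition soc_vec s x : 'cV[R]_(sdim s) := sC s *m x + sxi s.

Definition soc_bound s x z : R := dot (szeta s) x + dot (seta s) z + stheta s.

Definition soc_sat s x z : Prop := enorm (soc_vec s x) <= soc_bound s x z.

Definition rank1_lift x z : lifted R n q :=
  Lifted x (x *m x^T) z (x *m z^T) (z *m z^T).

(** At a rank-one point the SST matrix is the outer product of the two cone
    vectors and [sst_beta] is the product of the two bounds, so the constraint
    is the product of the two cone inequalities, whose sides are
    nonnegative. *)
Lemma sst_rank1 s t x z :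
  soc_sat s x z -> soc_sat t x z -> sst (rank1_lift x z) s t.
Proof.
move=> hs ht; rewrite /sst /=.
have -> : sC s *m (x *m x^T) *m (sC t)^T + sC s *m x *m (sxi t)^T
          + sxi s *m x^T *m (sC t)^T + sxi s *m (sxi t)^T
          = soc_vec s x *m (soc_vec t x)^T.
  by rewrite /soc_vec [(_ + _)^T]raddfD /= trmx_mul mulmxDl !mulmxDr !mulmxA !addrA.
rewrite fnorm_outer.
have -> : sst_beta (rank1_lift x z) s t = soc_bound s x z * soc_bound t x z.
  rewrite /sst_beta /soc_bound /= !mulmx_outer !dotlin !(dotC _ x) !(dotC _ z).
  by ring.
by apply: ler_pM => //; apply: enorm_ge0.
Qed.

Lemma psd_rank1_lift x z : psd (lift_mx (rank1_lift x z)).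
Proof.
set u : 'cV[R]_(1 + (n + q)) := col_mx 1%:M (col_mx x z).
have -> : lift_mx (rank1_lift x z) = u *m u^T.
  rewrite /lift_mx /= /u !tr_col_mx trmx1 !mul_col_row mul1mx mulmx1 mul1mx.
  by rewrite trmx_mul trmxK.
exact: psd_outer.
Qed.

Lemma col_mx_vcons p (A : 'M[R]_(p, n)) (k e : R) c (v : 'cV[R]_p) x :
  col_mx A (k *: c^T) *m x + vcons v e
  = vcons (A *m x + v) (k * dot c x + e).
Proof.
rewrite /vcons mul_col_mx add_col_mx -scalemxAl [c^T *m x]mx11_scalar -dotE.
by rewrite scale_scalar_mx -raddfD.
Qed.

Lemma col_mx0_vcons p (A : 'M[R]_(p, n)) (e : R) (v : 'cV[R]_p) x :
  col_mx A 0 *m x + vcons v e = vcons (A *m x + v) e.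
Proof. by rewrite /vcons mul_col_mx mul0mx add_col_mx add0r. Qed.

End SecondOrderCone.

(** * The lifting of a feasible point *)

Section Lifting.
Context {R : realType} {n l m : nat} {D : qcqp R n l m} {F : factors R n l}.
Hypotheses (hD : qcqp_wf D) (hF : factors_wf D F).
Implicit Types (x : 'cV[R]_n) (i : 'I_l) (j : 'I_m) (r : 'I_(nn D)).

Definition quad_con i x : R :=
  dot x (qQ D i *m x) + dot (qc D i) x + qd D i.

Lemma quad_con_shift i x : in_range (qQ D i) (qc D i) ->
  dot (x + pshift D i) (qQ D i *m (x + pshift D i)) = quad_con i x + delta D i.
Proof. by move=> rg; apply: complete_square => //; case: (hD.2 i). Qed.

Lemma cvx_form i x : i \in cvx D ->
  dot x (qQ D i *m x) = dot (fB F i *m x) (fB F i *m x).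
Proof. by move=> iC; rewrite hF.1 // dot_gram. Qed.

Lemma ncvx_form r x : dot x (qQ D (nidx r) *m x)
  = dot (fL F (nidx r) *m x) (fL F (nidx r) *m x)
    - dot (fM F (nidx r) *m x) (fM F (nidx r) *m x).
Proof. by apply: spectral_dec_form; apply/hF.2/enum_valP. Qed.

Lemma soc_vecA1 r x : soc_vec (socA1 F r) x
  = vcons (fL F (nidx r) *m x)
          (2^-1 * (dot (qc D (nidx r)) x + qd D (nidx r) + 1)).
Proof.
rewrite /soc_vec /= col_mx_vcons addr0; congr vcons; ring.
Qed.

Lemma soc_vecA2 r x : soc_vec (socA2 F r) x
  = vcons (fM F (nidx r) *m x)
          (2^-1 * (dot (qc D (nidx r)) x + qd D (nidx r) - 1)).
Proof.
rewrite /soc_vec /= col_mx_vcons addr0; congr vcons; ring.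
Qed.

Definition range_ok (ty : gsrt_type) : Prop := ty = TypeB ->
  forall i : 'I_l, i \in ncvx D -> in_range (qQ D i) (qc D i).

(** For each type the two cone vectors of a nonconvex constraint split
    [quad_con] into a difference of two squared norms: type A by
    [w = ((w + 1) / 2) ^ 2 - ((w - 1) / 2) ^ 2] for the affine part [w],
    type B by completing the square. *)
Lemma soc_gap ty r x : range_ok ty ->
  dot (soc_vec (soc1 F ty r) x) (soc_vec (soc1 F ty r) x)
  - dot (soc_vec (soc2 F ty r) x) (soc_vec (soc2 F ty r) x)
  = quad_con (nidx r) x.
Proof.
case: ty => rg; rewrite /soc1 /soc2.
  by rewrite soc_vecA1 soc_vecA2 !dot_vcons /quad_con ncvx_form; field.
have /quad_con_shift h : in_range (qQ D (nidx r)) (qc D (nidx r)).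
  by apply: rg => //; apply: enum_valP.
have -> : quad_con (nidx r) x = quad_con (nidx r) x + delta D (nidx r)
                                - delta D (nidx r) by ring.
rewrite -h ncvx_form /socB1 /socB2; case: ifPn => dl; rewrite /soc_vec /=.
  rewrite col_mx0_vcons dot_vcons -!mulmxDr -expr2 sqr_sqrtr ?ltW //; ring.
rewrite col_mx0_vcons dot_vcons -!mulmxDr -expr2 sqr_sqrtr; first by ring.
by rewrite oppr_ge0 leNgt.
Qed.

(** Dictated by the equations for the diagonal of [Z], which ask that [z r ^ 2]
    be the squared norm of the second cone vector. *)
Definition zlift ty x : 'cV[R]_(nn D) :=
  \col_r enorm (soc_vec (soc2 F ty r) x).

Lemma soc_bound1 ty r x z : soc_bound (soc1 F ty r) x z = z r ord0.
Proof.
rewrite /soc_bound; case: ty; rewrite /= ?/socB1; last case: ifP => _;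
  by rewrite /= dot0l dot_unitv add0r addr0.
Qed.

Lemma soc_bound2 ty r x z : soc_bound (soc2 F ty r) x z = z r ord0.
Proof.
rewrite /soc_bound; case: ty; rewrite /= ?/socB2; last case: ifP => _;
  by rewrite /= dot0l dot_unitv add0r addr0.
Qed.

Lemma soc_sat2 ty r x : soc_sat (soc2 F ty r) x (zlift ty x).
Proof. by rewrite /soc_sat soc_bound2 mxE. Qed.

Lemma soc_sat1 ty r x : range_ok ty -> P_feasible D x ->
  soc_sat (soc1 F ty r) x (zlift ty x).
Proof.
move=> rg [hq _]; rewrite /soc_sat soc_bound1 mxE.
apply: enorm_le; first exact: enorm_ge0.
by rewrite sqr_enorm -subr_le0 soc_gap //; apply: hq.
Qed.

(** In the first form, [|B x| ^ 2 + w <= 0] for the affine part [w] is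
    [|B x| ^ 2 + ((1 + w) / 2) ^ 2 <= ((1 - w) / 2) ^ 2]; in the alternative
    form the square is completed. *)
Lemma soc_sat_cvx alt i x z : i \in cvx D -> P_feasible D x ->
  alt_ok D alt -> soc_sat (soc_cvx D F alt i) x z.
Proof.
move=> iC [hq _] halt; have := hq i; rewrite -/(quad_con i x) => qle.
rewrite /soc_sat /soc_cvx /soc_bound /soc_vec.
case: ifPn => [ia|_] /=.
  have [_ rg d0] := halt i ia.
  rewrite -mulmxDr !dot0l !add0r; apply: enorm_le; first exact: sqrtr_ge0.
  by rewrite sqr_sqrtr // -cvx_form // quad_con_shift // gerDr.
rewrite -scaleNr col_mx_vcons addr0 dot0l -scaleNr dotZl.
move: qle; rewrite /quad_con cvx_form // => qle.
have B0 := dot_ge0 (fB F i *m x).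
apply: enorm_le; first by lra.
rewrite dot_vcons -subr_le0.
(* The two sides differ by the value of the quadratic constraint. *)
suff -> : forall b w e : R, b + (- 2^-1 * w + 2^-1 * (- e - 1))
    * (- 2^-1 * w + 2^-1 * (- e - 1))
    - (- 2^-1 * w + 0 + 2^-1 * (1 - e)) ^+ 2 = b + w + e by [].
by move=> b w e; field.
Qed.

Lemma soc_sat_gsoc ty alt x (s : 'I_(2 * l - #|cvx D|)) :
  range_ok ty -> alt_ok D alt -> P_feasible D x ->
  soc_sat (tnth (gsoc D F ty alt) s) x (zlift ty x).
Proof.
move=> rg halt Px; apply/asboolP; move: s.
apply/(all_tnthP (a := fun s => `[< soc_sat s x (zlift ty x) >])).
rewrite /gsoc /= /gsoc_seq !all_cat !all_map; apply/and3P; split.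
- apply/allP => i; rewrite mem_enum => iC /=.
  by apply/asboolP/soc_sat_cvx.
- by apply/allP => r _ /=; apply/asboolP/soc_sat1.
- by apply/allP => r _ /=; apply/asboolP/soc_sat2.
Qed.

Definition slack j x : R := qb D j - dot (qa D j) x.

Lemma slack_ge0 j x : P_feasible D x -> 0 <= slack j x.
Proof. by case=> _ ha; rewrite subr_ge0. Qed.

(** At a rank-one point the vectors and the right-hand side of the constraints
    indexed by [j] are those of the cone constraints times the slack of the
    linear constraint [j]. *)
Lemma slackZ j x : qb D j *: x - x *m x^T *m qa D j = slack j x *: x.
Proof. by rewrite mulmx_outer -scalerBl (dotC x). Qed.

Lemma slack_bound j r x (z : 'cV[R]_(nn D)) :
  z r ord0 * qb D j - dot (col r (x *m z^T)) (qa D j) = slack j x * z r ord0.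
Proof.
have -> : col r (x *m z^T) = z r ord0 *: x.
  by apply/colP => i; rewrite !mxE big_ord1 mxE mulrC.
by rewrite dotZl (dotC x) -mulrBr mulrC.
Qed.

Lemma enorm_scale_le p (k b b' : R) (u v : 'cV[R]_p) :
  0 <= k -> enorm v <= b -> u = k *: v -> b' = k * b -> enorm u <= b'.
Proof. by move=> k0 vb -> ->; rewrite enormZ // ler_wpM2l. Qed.

Lemma base_constraints_lift x (z : 'cV[R]_(nn D)) : P_feasible D x ->
  base_constraints (D := D) F (rank1_lift x z).
Proof.
move=> Px; have [hq ha] := Px; split => //=.
- by move=> i; rewrite mdot_outer.
- exact: psd_rank1_lift.
- move=> i j _; rewrite mdot_outer mulmx_outer dotZr (dotC x).
  have := mulr_ge0 (slack_ge0 i Px) (slack_ge0 j Px).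
  by congr (_ <= _); rewrite /slack; ring.
- move=> i j iC.
  have halt : alt_ok D finset.set0 by move=> k; rewrite inE.
  have := soc_sat_cvx z iC Px halt.
  rewrite /soc_sat /soc_bound /soc_vec /soc_cvx inE /=.
  rewrite -!scaleNr col_mx_vcons addr0 dot0l dotZl => sat.
  (* The last entry here is the opposite of the one in the cone vector. *)
  rewrite -enorm_vconsN in sat.
  apply: (enorm_scale_le (slack_ge0 j Px) sat).
    rewrite slackZ -scalemxAr scale_vcons mulmx_outer !dotlin (dotC x).
    by congr vcons; rewrite /slack; field.
  by rewrite mulmx_outer !dotlin (dotC x) /slack; field.
Qed.

Lemma Zlift_diag ty r x :
  (zlift ty x *m (zlift ty x)^T) r r
  = dot (soc_vec (soc2 F ty r) x) (soc_vec (soc2 F ty r) x).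
Proof. by rewrite mxE big_ord1 [_^T _ _]mxE mxE -expr2 sqr_enorm. Qed.

Lemma typeA_constraints_lift r x : P_feasible D x ->
  typeA_constraints F (rank1_lift x (zlift TypeA x)) r.
Proof.
move=> Px; have rg : range_ok TypeA by [].
have sat1 := soc_sat1 r rg Px; have sat2 := soc_sat2 TypeA r x.
have Zd := Zlift_diag TypeA r x.
rewrite /soc_sat soc_bound1 [soc_vec _ _]soc_vecA1 in sat1.
rewrite /soc_sat soc_bound2 [soc_vec _ _]soc_vecA2 in sat2.
rewrite [soc_vec _ _]soc_vecA2 dot_vcons in Zd.
split => //=.
- rewrite Zd mdotC !mdot_outer dot_gram mulmx_outer dotZr (dotC x).
  by field.
- move=> j; rewrite slackZ slack_bound.
  apply: (enorm_scale_le (slack_ge0 j Px) sat1) => //.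
  rewrite scale_vcons -scalemxAr dotZr -/(slack j x).
  by congr vcons; ring.
- move=> j; rewrite slackZ slack_bound.
  apply: (enorm_scale_le (slack_ge0 j Px) sat2) => //.
  rewrite scale_vcons -scalemxAr dotZr -/(slack j x).
  by congr vcons; ring.
Qed.

(** The second matrix is [(x + p) (x + p)^T] with the cross terms
    [p x^T + x p^T] replaced by [2 p x^T]; the symmetric [M^T M] does not
    distinguish them. *)
Lemma typeB_lift_pi r x (M := fM F (nidx r)) :
  mdot (M^T *m M)
    (x *m x^T + 4^-1 *: (Qd D (nidx r) *m qc D (nidx r)
                           *m (qc D (nidx r))^T *m Qd D (nidx r))
     + Qd D (nidx r) *m qc D (nidx r) *m x^T)
  = dot (M *m (x + pshift D (nidx r))) (M *m (x + pshift D (nidx r))).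
Proof.
rewrite /pshift; set g := Qd D (nidx r) *m qc D (nidx r).
have -> : g *m (qc D (nidx r))^T *m Qd D (nidx r) = g *m g^T.
  have tQd : (Qd D (nidx r))^T = Qd D (nidx r).
    by apply: trmx_mp_inverse; case: (hD.2 (nidx r)).
  by rewrite [in RHS]/g trmx_mul tQd mulmxA.
rewrite !mdotDr mdotZr !mdot_outer !dot_gram mulmxDr -scalemxAr !dotlin.
by rewrite (dotC (M *m x) (M *m g)); field.
Qed.

Lemma typeB_constraints_lift r x : range_ok TypeB -> P_feasible D x ->
  typeB_constraints F (rank1_lift x (zlift TypeB x)) r.
Proof.
move=> rg Px; have := soc_sat1 r rg Px; have := soc_sat2 TypeB r x.
have := Zlift_diag TypeB r x.
rewrite /soc_sat soc_bound1 soc_bound2 /typeB_constraints /=.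
rewrite typeB_lift_pi.
have wE j : qb D j *: x - x *m x^T *m qa D j
    + (qb D j - dot (qa D j) x) *: pshift D (nidx r)
    = slack j x *: (x + pshift D (nidx r)) by rewrite slackZ scalerDr.
rewrite /socB1 /socB2; case: ifPn => dl; rewrite /soc_vec /= col_mx0_vcons -!mulmxDr.
  rewrite dot_vcons -expr2 sqr_sqrtr; last exact: ltW.
  move=> -> sat2 sat1.
  split => // j; rewrite wE (dotC _ (col _ _)) slack_bound.
    by apply: (enorm_scale_le (slack_ge0 j Px) sat1); rewrite ?scalemxAr.
  apply: (enorm_scale_le (slack_ge0 j Px) sat2) => //.
  by rewrite scale_vcons scalemxAr mulrC.
move=> -> sat2 sat1; split => // j; rewrite wE (dotC _ (col _ _)) slack_bound.
  apply: (enorm_scale_le (slack_ge0 j Px) sat1) => //.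
  by rewrite scale_vcons scalemxAr mulrC.
by apply: (enorm_scale_le (slack_ge0 j Px) sat2); rewrite ?scalemxAr.
Qed.

Lemma rank1_lift_feasible ty alt x :
  range_ok ty -> alt_ok D alt -> P_feasible D x ->
  gsrt_sst_feasible (D := D) F ty alt (rank1_lift x (zlift ty x)).
Proof.
move=> rg halt Px; split; last first.
  by move=> s t _; apply: sst_rank1; apply: soc_sat_gsoc.
split; rewrite /= ?trmx_mul ?trmxK //; first exact: base_constraints_lift.
case: ty rg => rg r; first exact: typeA_constraints_lift.
exact: typeB_constraints_lift.
Qed.

End Lifting.

(** * The comparison of optimal values *)

Theorem theorem4p1 (R : realType) (n l m : nat) (D : qcqp R n l m)
    (F : factors R n l) (ty : gsrt_type) (alt : {set 'I_l})
    (hD : qcqp_wf D) (hF : factors_wf D F) (halt : alt_ok D alt)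
    (hty : ty = TypeB ->
      forall i : 'I_l, i \in ncvx D -> in_range (qQ D i) (qc D i)) :
  (sdp_val (gsrt_sst_feasible (D := D) F ty alt) <= P_val D)%E /\
  (sdp_val (gsrt_feasible (D := D) F ty)
     <= sdp_val (gsrt_sst_feasible (D := D) F ty alt))%E.
Proof.
split; apply: ereal_inf_le_tmp => _ [y hy <-].
  exists (rank1_lift y (zlift (F := F) ty y)); first exact: rank1_lift_feasible.
  by rewrite /= mdot_outer.
by exists y => //; case: hy.
Qed.
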